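(* Let $1<p<\infty$, let $r,s$ be (real or complex) numbers, and let $U(s,r,s)$ be the bounded linear operator on $\ell_p$ defined by the symmetric tri-band matrix with $r$ on the main diagonal and $s$ on the first super- and sub-diagonals. Then the residual spectrum of $U(s,r,s)$ on $\ell_p$ is empty: $$\sigma_r\left(U(s,r,s),\ell_p\right)=\varnothing .$$
   Context: $\mathbb{N}=\{0,1,2,\dots\}$. $\ell_p$ is the complex Banach space of sequences $x=(x_k)_{k\in\mathbb{N}}$ with $\sum_k|x_k|^p<\infty$, with its usual norm. The operator $U(s,r,s)$ acts by $(U(s,r,s)x)_k=sx_{k-1}+rx_k+sx_{k+1}$ for $k\in\mathbb{N}$, with the convention $x_{-1}=0$. For a bounded linear operator $T$ on a complex Banach space $X$, the residual spectrum $\sigma_r(T,X)$ is the set of all $\lambda\in\mathbb{C}$ such that $T-\lambda I$ is injective but its range (the domain of $(T-\lambda I)^{-1}$) is not dense in $X$. (The subscript $r$ in $\sigma_r$ stands for ''residual'' and is unrelated to the number $r$.) *)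

(* Defs.v *)
From HB Require Import structures.
From mathcomp Require Import all_boot all_order all_algebra.
From mathcomp Require Import complex ring.
From mathcomp Require Import all_classical all_reals all_analysis.

Set Implicit Arguments.
Unset Strict Implicit.
Unset Printing Implicit Defensive.
Import Order.TTheory GRing.Theory Num.Theory.
Import numFieldNormedType.Exports.
Local Open Scope classical_set_scope.
Local Open Scope complex_scope.
Local Open Scope ring_scope.

(* [normc] is the [R]-valued modulus on [R[i]]; the norm [`|_|] of a normed
   module over [R[i]] is [R[i]]-valued. *)

Local Notation normc := (@Normc.normc _).

Section lp_sum.
Context {R : realType}.
Implicit Types (p : R) (x y : nat -> R[i]) (a : R[i]).

Definition lp_sum p x : \bar R :=
  (\sum_(0 <= k <oo) (normc (x k) `^ p)%:E)%E.

Definition lp_summable p : {pred nat -> R[i]} :=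
  mem [set x | (lp_sum p x < +oo)%E].

Definition lp_norm p x : R := fine (lp_sum p x) `^ p^-1.

Lemma normc_ge0 a : 0 <= normc a.
Proof. by case: a => u v; rewrite /normc sqrtr_ge0. Qed.

Lemma norm_normc a : `|a| = (normc a)%:C.
Proof. by case: a. Qed.

Lemma lp_term_ge0 p x k : (0 <= (normc (x k) `^ p)%:E)%E.
Proof. by rewrite lee_fin powR_ge0. Qed.

Lemma lp_sum_ge0 p x : (0 <= lp_sum p x)%E.
Proof. by apply: nneseries_ge0 => k _ _; exact: lp_term_ge0. Qed.

Lemma lp_summableE p x : (x \in lp_summable p) = (lp_sum p x < +oo)%E.
Proof. by apply/idP/idP; rewrite inE. Qed.

Lemma lp_sum_fin p x : x \in lp_summable p -> lp_sum p x \is a fin_num.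
Proof. by rewrite lp_summableE ge0_fin_numE// lp_sum_ge0. Qed.

Lemma lp_sum_Lnorm p x : 0 < p ->
  ((lp_sum p x) `^ p^-1 = 'N[counting]_p%:E[EFin \o (normc \o x)])%E.
Proof.
move=> p0; rewrite Lnorm_counting//; congr (_ `^ _)%E.
apply: eq_eseriesr => k _ /=.
by rewrite ger0_norm ?normc_ge0// poweR_EFin.
Qed.

Lemma lp_norm_Lnorm p x : 0 < p -> x \in lp_summable p ->
  ((lp_norm p x)%:E = 'N[counting]_p%:E[EFin \o (normc \o x)])%E.
Proof.
by move=> p0 xp; rewrite -lp_sum_Lnorm// /lp_norm -poweR_EFin fineK// lp_sum_fin.
Qed.

Lemma lp_sum0 p : 0 < p -> lp_sum p 0 = 0%E.
Proof.
by move=> p0; apply: eseries0 => k _ _; rewrite Normc.normc0 powR0 ?gt_eqF.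
Qed.

Lemma lp_sumZ p a x : (lp_sum p (a *: x) = (normc a `^ p)%:E * lp_sum p x)%E.
Proof.
rewrite /lp_sum -nneseriesZl; last by move=> k _; exact: lp_term_ge0.
apply: eq_eseriesr => k _.
by rewrite -EFinM -powRM ?normc_ge0// -Normc.normcM.
Qed.

Lemma lp_summableZ p a x :
  x \in lp_summable p -> a *: x \in lp_summable p.
Proof.
rewrite !lp_summableE lp_sumZ => xp.
by apply: lte_mul_pinfty => //; rewrite lee_fin powR_ge0.
Qed.


Lemma lp_minkowski p x y : 1 <= p ->
  ('N[counting]_p%:E[EFin \o (normc \o (x + y)%R)] <=
   'N[counting]_p%:E[EFin \o (normc \o x)] +
   'N[counting]_p%:E[EFin \o (normc \o y)])%E.
Proof.
move=> p1; have p0 : 0 < p by exact: lt_le_trans p1.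
have mf (f : nat -> R) : measurable_fun [set: nat] f by [].
apply: (le_trans _ (@minkowski_EFin _ _ _ counting _ _ p (mf _) (mf _) p1)).
rewrite !Lnorm_counting//; apply: gt0_ler_poweR.
- by rewrite invr_ge0 ltW.
- by rewrite in_itv/= leey andbT nneseries_ge0// => *; exact: poweR_ge0.
- by rewrite in_itv/= leey andbT nneseries_ge0// => *; exact: poweR_ge0.
apply: lee_nneseries => k _ //=.
rewrite lee_fin; apply: ge0_ler_powR; rewrite ?nnegrE ?normr_ge0//.
  exact: ltW.
rewrite [in leLHS]ger0_norm ?normc_ge0// [in leRHS]ger0_norm; last first.
  by rewrite addr_ge0 ?normc_ge0.
exact: le_normcD.
Qed.

Lemma lp_summableD p x y : 1 <= p ->
  x \in lp_summable p -> y \in lp_summable p -> x + y \in lp_summable p.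
Proof.
move=> p1 xp yp; have p0 : 0 < p by exact: lt_le_trans p1.
rewrite lp_summableE; apply: (@lty_poweRy _ _ p^-1).
  by rewrite gt_eqF ?invr_gt0.
rewrite lp_sum_Lnorm//; apply: (le_lt_trans (lp_minkowski _ _ p1)).
by rewrite -!lp_norm_Lnorm// -EFinD ltry.
Qed.

Lemma lp_summable_submod_closed p : 1 <= p -> submod_closed (lp_summable p).
Proof.
move=> p1; split; first by rewrite lp_summableE lp_sum0// (lt_le_trans _ p1).
by move=> a x y xp yp; exact: lp_summableD p1 (lp_summableZ _ xp) yp.
Qed.

Lemma lp_normD p x y : 1 <= p ->
  x \in lp_summable p -> y \in lp_summable p ->
  lp_norm p (x + y) <= lp_norm p x + lp_norm p y.
Proof.
move=> p1 xp yp; have p0 : 0 < p by exact: lt_le_trans p1.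
have xyp := lp_summableD p1 xp yp.

have := lp_minkowski x y p1.
rewrite -(lp_norm_Lnorm p0 xp) -(lp_norm_Lnorm p0 yp) -(lp_norm_Lnorm p0 xyp).
by rewrite -EFinD lee_fin.
Qed.

Lemma lp_normZ p a x : 0 < p -> lp_norm p (a *: x) = normc a * lp_norm p x.
Proof.
move=> p0; rewrite /lp_norm lp_sumZ.
have [->|xp] := eqVneq (lp_sum p x) +oo%E; last first.
  have xfin : lp_sum p x \is a fin_num.
    by rewrite ge0_fin_numE ?lp_sum_ge0// ltey.
  rewrite fineM//=.
  rewrite powRM ?powR_ge0 ?fine_ge0 ?lp_sum_ge0//.
  by rewrite -powRrM mulfV ?gt_eqF// powRr1 ?normc_ge0.
rewrite /= powR0 ?invr_neq0 ?gt_eqF// mulr0.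
have := powR_ge0 (normc a) p; rewrite le_eqVlt => /predU1P[<-|a0].
  by rewrite mul0e/= powR0 ?invr_neq0 ?gt_eqF.
by rewrite gt0_muley ?lte_fin//= powR0 ?invr_neq0 ?gt_eqF.
Qed.

Lemma lp_term_le_sum p x k : ((normc (x k) `^ p)%:E <= lp_sum p x)%E.
Proof.
apply: (@le_trans _ _ (\sum_(0 <= i < k.+1) (normc (x i) `^ p)%:E)%E).
  rewrite big_nat_recr//= leeDr// sume_ge0// => i _; exact: lp_term_ge0.
by apply: nneseries_lim_ge => i _ _; exact: lp_term_ge0.
Qed.

Lemma normc_le_lp_norm p x k : 0 < p -> x \in lp_summable p ->
  normc (x k) <= lp_norm p x.
Proof.
move=> p0 xp.
rewrite -[leLHS](@powRr1 _ (normc (x k))) ?normc_ge0//.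
rewrite -(@mulfV _ p) ?gt_eqF// powRrM /lp_norm.
apply: ge0_ler_powR.
- by rewrite invr_ge0 ltW.
- by rewrite nnegrE powR_ge0.
- by rewrite nnegrE fine_ge0// lp_sum_ge0.
by rewrite -lee_fin fineK ?lp_sum_fin// lp_term_le_sum.
Qed.

Lemma lp_norm_ge0 p x : 0 <= lp_norm p x.
Proof. exact: powR_ge0. Qed.

Lemma lp_norm_powR p x : 0 < p -> x \in lp_summable p ->
  lp_sum p x = (lp_norm p x `^ p)%:E.
Proof.
move=> p0 xp; rewrite /lp_norm -powRrM mulVf ?gt_eqF// powRr1.
  by rewrite fineK ?lp_sum_fin.
by rewrite fine_ge0 ?lp_sum_ge0.
Qed.

Lemma lp_sum_le p x (M : R) : 0 < p -> x \in lp_summable p ->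
  lp_norm p x <= M -> (lp_sum p x <= (M `^ p)%:E)%E.
Proof.
move=> p0 xp xM; rewrite (lp_norm_powR p0 xp) lee_fin.
have M0 : 0 <= M by exact: le_trans (lp_norm_ge0 p x) xM.
by apply: (ge0_ler_powR (ltW p0)); rewrite ?nnegrE ?lp_norm_ge0.
Qed.

Lemma lp_norm_le p x (M : R) : 0 < p -> 0 <= M ->
  (lp_sum p x <= (M `^ p)%:E)%E -> x \in lp_summable p /\ lp_norm p x <= M.
Proof.
move=> p0 M0 xM; have xp : x \in lp_summable p.
  by rewrite lp_summableE (le_lt_trans xM)// ltry.
split => //; rewrite -(@powRr1 _ M)// -(@mulfV _ p) ?gt_eqF// powRrM.
apply: ge0_ler_powR.
- by rewrite invr_ge0 ltW.
- by rewrite nnegrE fine_ge0// lp_sum_ge0.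
- by rewrite nnegrE powR_ge0.
by rewrite -lee_fin fineK// lp_sum_fin.
Qed.

Let trunc n x : nat -> R[i] := fun k => if (k < n)%N then x k else 0.

Let lp_sum_trunc p n x : 0 < p ->
  lp_sum p (trunc n x) = (\sum_(0 <= k < n) normc (x k) `^ p)%:E.
Proof.
move=> p0; rewrite /lp_sum (nneseries_split 0%N n); last first.
  by move=> k _; exact: lp_term_ge0.
rewrite add0n [X in (_ + X)%E]eseries0 ?adde0; last first.
  move=> k nk _; rewrite /trunc ifN -?leqNgt//.
  by rewrite Normc.normc0 powR0 ?gt_eqF.
rewrite sumEFin; congr EFin; apply: eq_big_nat => k /andP[_ kn].
by rewrite /trunc kn.
Qed.

Let trunc_summable p n x : 0 < p -> trunc n x \in lp_summable p.
Proof. by move=> p0; rewrite lp_summableE lp_sum_trunc// ltry. Qed.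

Let lp_norm_trunc p n x : 0 < p -> x \in lp_summable p ->
  lp_norm p (trunc n x) <= lp_norm p x.
Proof.
move=> p0 xp.
apply: (proj2 (lp_norm_le p0 (lp_norm_ge0 _ _) _)).
rewrite -(lp_norm_powR p0 xp) lp_sum_trunc// -sumEFin.
by apply: nneseries_lim_ge => k _ _; exact: lp_term_ge0.
Qed.

(* Fatou-type property, used for the completeness of [lp]. *)
Lemma lp_limit (p : R) (F : set_system (nat -> R[i])) (x z : nat -> R[i])
    (e : R) : 1 <= p -> 0 < e -> ProperFilter F ->
  (\forall y \near F, x - y \in lp_summable p /\ lp_norm p (x - y) <= e) ->
  (forall k d, 0 < d -> \forall y \near F, normc (y k - z k) <= d) ->
  x - z \in lp_summable p /\ lp_norm p (x - z) <= e + e.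
Proof.
move=> p1 e0 FF xF zF; have p0 : 0 < p by exact: lt_le_trans p1.
have ee0 : 0 <= e + e by rewrite addr_ge0// ltW.
apply: lp_norm_le => //.
apply: lime_le; first by apply: is_cvg_nneseries => k _ _; exact: lp_term_ge0.
apply: nearW => n; rewrite sumEFin -lp_sum_trunc//.
apply: (lp_sum_le p0 (trunc_summable _ _ p0)).
pose d := (e `^ p / n.+1%:R) `^ p^-1.
have d0 : 0 < d by rewrite powR_gt0// divr_gt0// powR_gt0.
have : F [set y : nat -> R[i] | forall i : 'I_n, normc (y i - z i) <= d].
  by apply: filter_forall => i; exact: zF.
move=> /(filterI xF)/filter_ex[y [[xyp xye] yz]].
have -> : trunc n (x - z) = trunc n (x - y) + trunc n (y - z).
  apply/funext => k; rewrite -[RHS]/(trunc n (x - y) k + trunc n (y - z) k).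
  rewrite /trunc; case: ifP => _; last by rewrite addr0.
  by rewrite -[LHS]/(x k - z k) -[RHS]/((x k - y k) + (y k - z k)); ring.
apply: (le_trans (lp_normD p1 (trunc_summable _ _ p0) (trunc_summable _ _ p0))).
apply: lerD; first exact: le_trans (lp_norm_trunc _ p0 xyp) xye.
apply: (proj2 (lp_norm_le p0 (ltW e0) _)).
rewrite lp_sum_trunc// lee_fin.
apply: (@le_trans _ _ (\sum_(0 <= k < n) e `^ p / n.+1%:R)).
  apply: ler_sum_nat => k /andP[_ kn].
  have -> : e `^ p / n.+1%:R = d `^ p.
    by rewrite /d -powRrM mulVf ?gt_eqF// powRr1// divr_ge0 ?powR_ge0.
  apply: (ge0_ler_powR (ltW p0)); rewrite ?nnegrE ?normc_ge0 ?(ltW d0)//.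
  exact: (yz (Ordinal kn)).
rewrite sumr_const_nat subn0 -[leLHS]mulr_natr mulrAC ler_pdivrMr//.
by rewrite ler_wpM2l ?powR_ge0// ler_nat.
Qed.

Definition lshift_seq x : nat -> R[i] := fun k => x k.+1.

Definition rshift_seq x : nat -> R[i] := fun k => if k is j.+1 then x j else 0.

Lemma lp_sum_recl p x :
  (lp_sum p x = (normc (x 0%N) `^ p)%:E + lp_sum p (lshift_seq x))%E.
Proof.
rewrite {1}/lp_sum nneseries_recl//; last by move=> k _; exact: lp_term_ge0.
congr (_ + _)%E; rewrite /lp_sum.
rewrite -(@nneseries_addn _ (fun k => (normc (x k) `^ p)%:E) 1).
  by apply: eq_eseriesr => k _; rewrite addn1.
by move=> k; exact: lp_term_ge0.
Qed.

Lemma lp_sum_lshift p x : (lp_sum p (lshift_seq x) <= lp_sum p x)%E.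
Proof. by rewrite [leRHS]lp_sum_recl leeDr// lp_term_ge0. Qed.

Lemma lp_sum_rshift p x : 0 < p -> lp_sum p (rshift_seq x) = lp_sum p x.
Proof.
move=> p0; rewrite lp_sum_recl [rshift_seq x 0%N]/= -[normc _]/(normc (0 : R[i])).
by rewrite Normc.normc0 powR0 ?gt_eqF// add0e.
Qed.

Lemma lp_summable_lshift p x :
  x \in lp_summable p -> lshift_seq x \in lp_summable p.
Proof. by rewrite !lp_summableE; apply: le_lt_trans; exact: lp_sum_lshift. Qed.

Lemma lp_summable_rshift p x : 0 < p ->
  x \in lp_summable p -> rshift_seq x \in lp_summable p.
Proof. by move=> p0; rewrite !lp_summableE lp_sum_rshift. Qed.

Lemma lp_norm_lshift p x : 0 < p -> x \in lp_summable p ->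
  lp_norm p (lshift_seq x) <= lp_norm p x.
Proof.
move=> p0 xp; apply: ge0_ler_powR.
- by rewrite invr_ge0 ltW.
- by rewrite nnegrE fine_ge0// lp_sum_ge0.
- by rewrite nnegrE fine_ge0// lp_sum_ge0.
by rewrite fine_le ?lp_sum_fin ?lp_summable_lshift// lp_sum_lshift.
Qed.

Lemma lp_norm_rshift p x : 0 < p -> lp_norm p (rshift_seq x) = lp_norm p x.
Proof. by move=> p0; rewrite /lp_norm lp_sum_rshift. Qed.

End lp_sum.

(* The otherwise unused parameter [p1] makes it possible to infer the normed
   module structure, which requires [1 <= p], from the type alone. *)
Record lp (R : realType) (p : R) (p1 : 1 <= p) : Type := Lp {
  lp_seq :> nat -> R[i] ;
  _ : lp_seq \in lp_summable p }.

Section lp_space.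
Context {R : realType} {p : R} (p1 : 1 <= p).
Notation lp := (lp p1).

HB.instance Definition _ := [isSub for @lp_seq R p p1].
HB.instance Definition _ := [Choice of lp by <:].
HB.instance Definition _ := GRing.isSubmodClosed.Build _ _ (lp_summable p)
  (lp_summable_submod_closed p1).
HB.instance Definition _ := [SubChoice_isSubLmodule of lp by <:].

Let p0 : 0 < p. Proof. exact: lt_le_trans p1. Qed.

Lemma lpP (x : lp) : (x : nat -> R[i]) \in lp_summable p.
Proof. exact: valP. Qed.

Let nrm (x : lp) : R[i] := (lp_norm p x)%:C.

Let nrmD x y : nrm (x + y) <= nrm x + nrm y.
Proof. by rewrite /nrm -rmorphD lecR lp_normD ?lpP. Qed.

Let nrmZ (a : R[i]) x : nrm (a *: x) = `|a| * nrm x.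
Proof. by rewrite /nrm norm_normc -rmorphM; congr (_%:C); exact: lp_normZ. Qed.

Let nrm_eq0 x : nrm x = 0 -> x = 0.
Proof.
move=> -[nx0]; apply/val_inj/funext => k.
apply/Normc.eq0_normc/eqP; rewrite eq_le normc_ge0 andbT.
by rewrite -nx0 normc_le_lp_norm ?lpP.
Qed.

HB.instance Definition _ := Lmodule_isNormed.Build R[i] lp nrmD nrmZ nrm_eq0.

Lemma lp_normE (x : lp) : `|x| = (lp_norm p x)%:C.
Proof. by []. Qed.

Let norm_coord (x y : lp) k (e : R) :
  `|x - y| < e%:C -> normc (x k - y k) < e.
Proof.
rewrite lp_normE ltcR; apply: le_lt_trans.
exact: (normc_le_lp_norm k p0 (lpP (x - y))).
Qed.

Let normc_Re (a : R[i]) : `|complex.Re a| <= normc a.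
Proof. by rewrite -lecR -norm_normc; exact: normc_ge_Re. Qed.

Let normc_Im (a : R[i]) : `|complex.Im a| <= normc a.
Proof.
case: a => u v; rewrite /normc /= -[leLHS]sqrtr_sqr ler_wsqrtr//.
by rewrite lerDr sqr_ge0.
Qed.

Let normc_ReIm (a : R[i]) : normc a <= `|complex.Re a| + `|complex.Im a|.
Proof.
case: a => u v; rewrite -[_ +i* _](_ : (u +i* 0) + (0 +i* v) = _); last first.
  by apply/eqP; rewrite eq_complex /= addr0 add0r !eqxx.
apply: (le_trans (le_normcD _ _)).
by rewrite /= expr0n /= addr0 add0r !sqrtr_sqr addr0 add0r.
Qed.

Lemma lp_complete (F : set_system lp) : ProperFilter F -> cauchy F -> cvg F.
Proof.
move=> FF /cauchy_ballP Fc.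
have Fe (e : R) : 0 < e -> \forall x \near F, \forall y \near F, `|x - y| < e%:C.
  move=> e0; apply: nearP_dep; have := Fc e%:C; rewrite ltcR => /(_ e0).
  by apply: filterS => -[x y]; rewrite -ball_normE.
have cvgf (f : R[i] -> R) : {morph f : a b / a - b} ->
    (forall a, `|f a| <= normc a) ->
    forall k, cvg ((fun x : lp => f (x k)) @ F).
  move=> fB fn k; apply: cauchy_cvg; apply: cauchy_exP => e e0.
  have [x Fx] := filter_ex (Fe e e0); exists (f (x k)).
  apply: filterS Fx => y xy; rewrite -ball_normE /= -fB.
  exact: le_lt_trans (fn _) (norm_coord k xy).
have cvgRe := cvgf (@complex.Re R) (fun a b => raddfB _ a b) normc_Re.
have cvgIm := cvgf (@complex.Im R) (fun a b => raddfB _ a b) normc_Im.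
pose z : nat -> R[i] := fun k => lim ((fun x : lp => complex.Re (x k)) @ F) +i*
  lim ((fun x : lp => complex.Im (x k)) @ F).
pose G : set_system (nat -> R[i]) := (@lp_seq R p p1) @ F.
have Gz k d : 0 < d -> \forall y \near G, normc (y k - z k) <= d.
  move=> d0; have d20 : 0 < d / 2 by rewrite divr_gt0.
  have /cvgrPdist_le/(_ _ d20) zRe := cvgRe k.
  have /cvgrPdist_le/(_ _ d20) zIm := cvgIm k.
  apply: filterS2 zRe zIm => y yRe yIm.
  apply: (le_trans (normc_ReIm _)); rewrite [leRHS]splitr lerD//.
    by rewrite raddfB/= distrC.
  by rewrite raddfB/= distrC.
have Fz e : 0 < e ->
    F [set x : lp | lp_seq x - z \in lp_summable p /\
                    lp_norm p (lp_seq x - z) <= e].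
  move=> e0; rewrite [e]splitr; have e20 : 0 < e / 2 by rewrite divr_gt0.
  apply: filterS (Fe _ e20) => x xF.
  apply: (lp_limit p1 e20 _ _ Gz).
  suff : F [set y : lp | lp_seq x - lp_seq y \in lp_summable p /\
      lp_norm p (lp_seq x - lp_seq y) <= e / 2] by [].
  apply: filterS xF => y xy; split; first exact: (lpP (x - y)).
  by apply: ltW; move: xy; rewrite lp_normE ltcR.
have [x0 [x0z _]] := filter_ex (Fz 1 ltr01).
have zp : z \in lp_summable p.
  have -> : z = lp_seq x0 - (lp_seq x0 - z).
    by apply/funext => k; rewrite subKr.
  by rewrite rpredB// lpP.
apply/cvg_ex; exists (Lp p1 zp); apply/cvgrPdist_le => e e0.
have [d d0 de] : exists2 d : R, 0 < d & d%:C <= e.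
  exists (complex.Re e); first by move: e0; rewrite ltcE => /andP[].
  by rewrite RRe_real// gtr0_real.
apply: filterS (Fz d d0) => x [_ xz]; apply: le_trans de.
by rewrite distrC lp_normE lecR.
Qed.

HB.instance Definition _ := Uniform_isComplete.Build lp lp_complete.

End lp_space.

Section tridiag.
Context {R : realType} {p : R} (p1 : 1 <= p).
Implicit Types (s r a : R[i]) (x y : lp p1).

(* Action of the infinite tri-band matrix with [r] on the main diagonal and [s]
   on the first sub- and super-diagonals; the entry before index 0 is read
   as 0. *)
Definition tridiag_seq s r (x : nat -> R[i]) : nat -> R[i] := fun k =>
  s * (if k is j.+1 then x j else 0) + r * x k + s * x k.+1.

Let p0 : 0 < p. Proof. exact: lt_le_trans p1. Qed.

Lemma tridiag_subproof s r x : tridiag_seq s r x \in lp_summable p.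
Proof.
rewrite [tridiag_seq _ _ _](_ : _ =
  s *: rshift_seq x + r *: (x : nat -> R[i]) + s *: lshift_seq x)//.
by rewrite !lp_summableD ?lp_summableZ ?lp_summable_rshift
  ?lp_summable_lshift ?lpP.
Qed.

Definition tridiag s r x : lp p1 := Lp p1 (tridiag_subproof s r x).

Lemma tridiag_linear s r : linear (tridiag s r).
Proof.
move=> a x y; apply/val_inj/funext => k.
rewrite -[RHS]/(a * tridiag_seq s r x k + tridiag_seq s r y k).
rewrite -[LHS]/(tridiag_seq s r (fun k => a * x k + y k) k).
by rewrite /tridiag_seq; case: k => [|k]; ring.
Qed.

HB.instance Definition _ s r :=
  GRing.isLinear.Build R[i] (lp p1) (lp p1) *:%R (tridiag s r)
    (tridiag_linear s r).

Lemma tridiag_norm_le s r x : `|tridiag s r x| <= (`|s| *+ 2 + `|r|) * `|x|.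
Proof.
rewrite !norm_normc !lp_normE -rmorphMn -rmorphD -rmorphM lecR.
rewrite [\val (tridiag _ _ _)](_ : _ = s *: rshift_seq x +
  r *: (x : nat -> R[i]) + s *: lshift_seq x)//.
have xp := lpP x.
have sl := lp_summableZ s (lp_summable_lshift xp).
have sr := lp_summableZ s (lp_summable_rshift p0 xp).
have rx := lp_summableZ r xp.
apply: (le_trans (lp_normD p1 (lp_summableD p1 sr rx) sl)).
apply: (le_trans (lerD (lp_normD p1 sr rx) (lexx _))).
rewrite (lp_normZ s _ p0) (lp_normZ r _ p0) (lp_normZ s _ p0).
rewrite (lp_norm_rshift _ p0).
rewrite mulrDl mulr2n mulrDl [leRHS]addrAC lerD2l.
by apply: ler_wpM2l; [exact: normc_ge0 | exact: lp_norm_lshift].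
Qed.

Lemma tridiag_continuous s r : continuous (tridiag s r).
Proof.
apply/linear_bounded_continuous/linear_boundedP.
near=> M => x; apply: (le_trans (tridiag_norm_le s r x)).
by apply: ler_wpM2r => //; near: M; exact: nbhs_pinfty_ge.
Unshelve. all: by end_near. Qed.

End tridiag.

Arguments tridiag {R p} p1 s r x.

Definition residual_spectrum (R : realType) (X : completeNormedModType R[i])
    (T : {linear X -> X}) : set R[i] :=
  [set l | injective (fun x => T x - l *: x) /\
           ~ dense (range (fun x => T x - l *: x))].

(* Main.v *)
Require Import Defs.
From mathcomp Require Import all_boot all_order all_algebra.
From mathcomp Require Import complex ring.
From mathcomp Require Import all_classical all_reals all_analysis.

Set Implicit Arguments.
Unset Strict Implicit.
Unset Printing Implicit Defensive.
Import Order.TTheory GRing.Theory Num.Theory.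
Import numFieldNormedType.Exports.
Local Open Scope classical_set_scope.
Local Open Scope complex_scope.
Local Open Scope ring_scope.

(* Let S be the right shift and S* the left shift.  Since S* S = 1, for s <> 0 and
   r - l = - s (z + z^-1) one has U - l = - (s / z) (1 - z S* ) (1 - z S), and z
   can be chosen with |z| <= 1.  The operator 1 - z S* maps finitely supported
   sequences onto finitely supported sequences, and 1 - z S has dense range when
   p > 1.  Hence U - l has dense range for every l, unless s = 0, where U - l is
   scalar. *)

Local Notation normc := (@Normc.normc _).

Lemma lec_halfD {R : realType} (e : R) (a b : R[i]) :
  a <= (e / 2)%:C -> b <= (e / 2)%:C -> a + b <= e%:C.
Proof. by move=> ae be; rewrite [e]splitr rmorphD lerD. Qed.

(** * Finitely supported sequences *)

Section FiniteSupport.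
Context {R : realType}.
Implicit Types (p c : R) (x : nat -> R[i]) (n : nat).

Definition finsupp n x := forall k, (n <= k)%N -> x k = 0.

Lemma lp_sum_finsupp_le p c n x : 0 < p -> finsupp n x ->
  (forall k, normc (x k) <= c) -> (lp_sum p x <= (n%:R * c `^ p)%:E)%E.
Proof.
move=> p0; elim: n x => [|n IH] x xn xc.
  by rewrite mul0r (_ : x = 0) ?lp_sum0//; apply/funext => k; exact: xn.
rewrite lp_sum_recl -nat1r mulrDl mul1r EFinD leeD//.
  rewrite lee_fin; apply: (ge0_ler_powR (ltW p0)); rewrite ?nnegrE ?normc_ge0//.
  exact: le_trans (normc_ge0 _) (xc 0%N).
by apply: IH => k; [move=> nk; apply: xn|exact: xc].
Qed.

Lemma finsupp_summable p n x : 0 < p -> finsupp n x -> x \in lp_summable p.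
Proof.
move=> p0; elim: n x => [|n IH] x xn.
  by rewrite lp_summableE (_ : x = 0) ?lp_sum0//; apply/funext => k; exact: xn.
rewrite lp_summableE lp_sum_recl lte_add_pinfty ?ltry//.
by rewrite -lp_summableE; apply: IH => k nk; exact: xn.
Qed.

End FiniteSupport.

(** * Shifts on l_p and norm approximation *)

Section Shifts.
Context {R : realType} {p : R} (p1 : 1 <= p).
Notation lp := (lp p1).
Implicit Types (x y w : lp) (a z : R[i]) (A B : set lp).

Let p0 : 0 < p. Proof. exact: lt_le_trans p1. Qed.

Definition cons_seq a (x : nat -> R[i]) : nat -> R[i] :=
  fun k => if k is j.+1 then x j else a.

Lemma lp_summable_cons a (x : nat -> R[i]) :
  x \in lp_summable p -> cons_seq a x \in lp_summable p.
Proof.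
by rewrite !lp_summableE => xp; rewrite lp_sum_recl lte_add_pinfty ?ltry.
Qed.

(** [lp_cons 0] is the right shift S, and [lp_cons 1 0] is the first unit vector e_0. *)
Definition lp_cons a x : lp := Lp p1 (lp_summable_cons a (lpP x)).

Definition lp_behead x : lp := Lp p1 (lp_summable_lshift (lpP x)).

Lemma lp_eqP x y : (forall k, x k = y k) -> x = y.
Proof. by move=> xy; apply/val_inj/funext. Qed.

Lemma norm_lp_cons0 x : `|lp_cons 0 x| = `|x|.
Proof.
exact: (congr1 (real_complex R) (lp_norm_rshift (\val x) p0)).
Qed.

Lemma norm_lp_behead x : `|lp_behead x| <= `|x|.
Proof. by rewrite !lp_normE lecR lp_norm_lshift// lpP. Qed.

(** Membership in the closure of [A], with the tolerance taken in [R] although the norm has values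
    in [R[i]]. *)
Definition approx A x :=
  forall e : R, 0 < e -> exists2 y, A y & `|x - y| <= e%:C.

Lemma approx_trans A B x :
  (forall y, B y -> approx A y) -> approx B x -> approx A x.
Proof.
move=> BA Bx e e0; have e20 : 0 < e / 2 by rewrite divr_gt0.
have [y By xy] := Bx _ e20; have [w Aw yw] := BA _ By _ e20.
exists w => //.
by apply: (le_trans (ler_distD y x w)); exact: lec_halfD xy yw.
Qed.

Lemma approx_dense A : (forall x, approx A x) -> dense A.
Proof.
move=> AT O [x Ox] Oo.
have /nbhs_ballP[e /= e0 xeO] : nbhs x O by exact: open_nbhs_nbhs.
(* In the order of [R[i]], a positive radius has zero imaginary part; half its real part will do. *)
have [d d0 de] : exists2 d : R, 0 < d & d%:C < e.
  move: e0 {xeO}; case: e => u v; rewrite ltcE/= => /andP[/eqP-> u0].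
  exists (u / 2); first by rewrite divr_gt0.
  by rewrite ltcE/= eqxx/= ltr_pdivrMr// ltr_pMr// ltr1n.
have [y Ay xy] := AT x d d0.
exists y; split => //; apply: xeO; rewrite -ball_normE/=.
exact: le_lt_trans xy de.
Qed.

(** Truncating at [n] leaves an error whose p-th power is a tail of the convergent series
    [lp_sum p x]. *)
Lemma approx_finsupp x : approx [set y : lp | exists n, finsupp n y] x.
Proof.
move=> e e0; have ep0 : 0 < e `^ p by rewrite powR_gt0.
have [n xn] : exists n,
    (\sum_(n <= k <oo) (normc (x k) `^ p)%:E < (e `^ p)%:E)%E.
  have : (lp_sum p x < +oo)%E by rewrite -lp_summableE lpP.
  move=> /nneseries_tail_cvg/(_ (fun k _ => lp_term_ge0 p x k)).
  have ep0' : (0 < (e `^ p)%:E)%E by rewrite lte_fin.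
  move=> /(_ _ (open_ereal_lt' ep0')) xoo.
  exact: (@filter_ex _ \oo _ _ xoo).
pose y k := if (k < n)%N then x k else 0.
have yn : finsupp n y by move=> k nk; rewrite /y ltnNge nk.
exists (Lp p1 (finsupp_summable p0 yn)); first by exists n.
rewrite lp_normE lecR; apply: (proj2 (lp_norm_le p0 (ltW e0) _)).
rewrite -[\val _]/(fun k => x k - y k) /lp_sum.
rewrite (nneseries_split 0%N n); last by move=> k _; rewrite lee_fin powR_ge0.
rewrite add0n big_nat big1 ?add0e => [|k /andP[_ kn]]; last first.
  by rewrite /y kn subrr Normc.normc0 powR0 ?gt_eqF.
apply: le_trans (ltW xn).
apply: lee_nneseries => [k _|k _]; rewrite lee_fin ?powR_ge0//.
apply: (ge0_ler_powR (ltW p0)); rewrite ?nnegrE ?normc_ge0// /y.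
by case: ifP; rewrite ?subr0// subrr Normc.normc0 normc_ge0.
Qed.

(** Backward recursion w_k = y_k + z w_(k+1), started from w_k = 0 for k >= n, solves the equation
    for any [z]. *)
Lemma finsupp_sub_behead z n y : finsupp n y ->
  exists2 w : lp, finsupp n w & y = w - z *: lp_behead w.
Proof.
elim: n y => [|n IH] y yn.
  by exists 0 => //; apply: lp_eqP => k; rewrite yn//; rewrite -[RHS]/(0 - z * 0); ring.
have [|w wn yw] := IH (lp_behead y); first by move=> k nk; apply: yn.
exists (lp_cons (y 0%N + z * w 0%N) w).
  by case=> // k; exact: wn.
apply: lp_eqP => -[|k].
  by rewrite -[RHS]/(y 0%N + z * w 0%N - z * w 0%N); ring.
exact: (congr1 (fun u : lp => u k) yw).
Qed.

(** Since [lp_cons a x] = a e_0 + S x and S commutes with 1 - z S, approximate preimages [u] of e_0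
    and [v] of [x] combine to a u + S v. This reduces density of the range to approximating e_0. *)
Lemma approx_cons z a x :
  approx (range (fun y => y - z *: lp_cons 0 y)) (lp_cons 1 0) ->
  approx (range (fun y => y - z *: lp_cons 0 y)) x ->
  approx (range (fun y => y - z *: lp_cons 0 y)) (lp_cons a x).
Proof.
move=> h1 hx e e0; have e20 : 0 < e / 2 by rewrite divr_gt0.
have a1 : 0 < normc a + 1 by rewrite ltr_wpDl ?normc_ge0.
(* The error of [u] gets multiplied by |a|; the added 1 covers a = 0. *)
have [_ [u _ <-] hu] := h1 (e / 2 / (normc a + 1)) (divr_gt0 e20 a1).
have [_ [v _ <-] hv] := hx _ e20.
exists ((a *: u + lp_cons 0 v) - z *: lp_cons 0 (a *: u + lp_cons 0 v)).
  by eexists.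
set U := lp_cons 1 0 - _ in hu; set V := x - _ in hv.
have -> : lp_cons a x - (a *: u + lp_cons 0 v -
    z *: lp_cons 0 (a *: u + lp_cons 0 v)) = a *: U + lp_cons 0 V.
  apply: lp_eqP => -[|k].
    rewrite -[LHS]/(a - (a * u 0%N + 0 - z * 0)).
    by rewrite -[RHS]/(a * (1 - (u 0%N - z * 0)) + 0); ring.
  rewrite -[LHS]/(x k - (a * u k.+1 + v k - z * (a * u k + cons_seq 0 v k))).
  rewrite -[RHS]/(a * (0 - (u k.+1 - z * u k)) +
    (x k - (v k - z * cons_seq 0 v k))).
  by ring.
apply: le_trans (ler_normD _ _) _.
rewrite normrZ norm_lp_cons0; apply: lec_halfD => //.
rewrite norm_normc (le_trans (ler_wpM2l _ hu)) ?lecR ?normc_ge0//.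
rewrite -rmorphM lecR mulrCA ler_piMr ?(ltW e20)// ler_pdivrMr// mul1r lerDl.
exact: ler01.
Qed.

End Shifts.

(** * Density of the range of U - l *)

Lemma natr_powR_archi {R : realType} (p e : R) : 1 < p -> 0 < e ->
  exists n, n.+1%:R * n.+1%:R^-1 `^ p <= e `^ p.
Proof.
move=> p1 e0; have p10 : 0 < p - 1 by rewrite subr_gt0.
(* With N = n + 1, the claim reads N^(1 - p) <= e^p, which holds once N >= M. *)
pose M := (e `^ p)^-1 `^ (p - 1)^-1.
have [n Mn] : exists n, M <= n%:R.
  by exists (Num.trunc M).+1; rewrite ltW// truncnS_gt.
exists n; have n0 : 0 < n.+1%:R :> R by [].
have h : (e `^ p)^-1 <= n.+1%:R `^ (p - 1).
  have <- : M `^ (p - 1) = (e `^ p)^-1.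
    by rewrite -powRrM mulVf ?gt_eqF// powRr1// invr_ge0 powR_ge0.
  apply: (ge0_ler_powR (ltW p10)); rewrite ?nnegrE ?powR_ge0//.
  by rewrite (le_trans Mn)// ler_nat.
rewrite -[in leLHS](powR_inv1 (ltW n0)) -powRrM.
rewrite -[X in X * _](powRr1 (ltW n0)) -powRD; last by rewrite (gt_eqF n0) implybT.
rewrite mulN1r -opprB powRN -[leRHS]invrK lef_pV2//= ?posrE ?invr_gt0 ?powR_gt0//.
Qed.

Section TridiagRange.
Context {R : realType} {p : R} (p_gt1 : 1 < p).
Let p1 : 1 <= p := ltW p_gt1.
Let p0 : 0 < p := lt_trans ltr01 p_gt1.
Notation lp := (lp p1).
Implicit Types (x y w : lp) (z : R[i]).

(* The Fejer-weighted geometric sequence z^k (1 - k/N), k < N, is mapped to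
   within O(N^(1/p - 1)) of the first unit vector; this needs p > 1. *)
Lemma approx_range_cons1 z : `|z| <= 1 ->
  approx (range (fun y => y - z *: lp_cons 0 y)) (lp_cons 1 (0 : lp)).
Proof.
rewrite norm_normc -[leRHS]/(1%:C) lecR => z1 e e0.
have [m hm] := natr_powR_archi p_gt1 e0.
set N := m.+1 in hm.
have N0 : N%:R != 0 :> R[i] by rewrite pnatr_eq0.
(* The truncated subtraction [N - k] makes [u] vanish from index N on. *)
pose u k : R[i] := z ^+ k * (N - k)%:R / N%:R.
have uN : finsupp N u.
  by move=> k; rewrite /u -subn_eq0 => /eqP->; rewrite mulr0 mul0r.
exists (Lp p1 (finsupp_summable p0 uN) -
    z *: lp_cons 0 (Lp p1 (finsupp_summable p0 uN))).
  by eexists.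
rewrite lp_normE lecR; apply: (proj2 (lp_norm_le p0 (ltW e0) _)).
rewrite lp_sum_recl.
set v := \val _.
have -> : v 0%N = 0.
  rewrite -[LHS]/(1 - (z ^+ 0 * (N - 0)%:R / N%:R - z * 0)).
  by rewrite expr0 subn0 mul1r mulfV// mulr0 subr0 subrr.
rewrite Normc.normc0 powR0 ?gt_eqF// add0e.
(* Consecutive weights differ by 1/N, so the error has N entries of modulus at most 1/N after its
   zero head. *)
have vE k : v k.+1 = if (k < N)%N then z ^+ k.+1 / N%:R else 0.
  rewrite -[LHS]/(0 - (u k.+1 - z * u k)); case: ltnP => kN.
    by rewrite /u -(subnSK kN) -natr1 exprS; field.
  by rewrite !uN// ?(leq_trans kN)// mulr0 !subr0.
apply: (@le_trans _ _ (N%:R * N%:R^-1 `^ p)%:E); last by rewrite lee_fin.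
apply: lp_sum_finsupp_le => // [k Nk|k]; rewrite /lshift_seq vE.
  by rewrite ltnNge Nk.
case: ifP => _; last by rewrite Normc.normc0 invr_ge0.
have -> : z ^+ k.+1 / N%:R = z ^+ k.+1 * (N%:R^-1 : R)%:C.
  by rewrite fmorphV rmorph_nat.
rewrite Normc.normcM.
have nX : normc (z ^+ k.+1) <= 1.
  by rewrite -lecR -norm_normc normrX exprn_ile1// norm_normc lecR// normc_ge0.
have -> : normc (N%:R^-1 : R)%:C = N%:R^-1.
  by rewrite /= expr0n /= addr0 sqrtr_sqr ger0_norm.
by rewrite ler_piMl.
Qed.

Lemma approx_range_sub_cons z n x : `|z| <= 1 -> finsupp n x ->
  approx (range (fun y => y - z *: lp_cons 0 y)) x.
Proof.
move=> z1; elim: n x => [|n IH] x xn.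
  move=> e e0; exists (0 - z *: lp_cons 0 0); first by eexists.
  rewrite (_ : _ - _ = 0) ?normr0 ?ler0c ?(ltW e0)//.
  apply: lp_eqP => k; rewrite -[LHS]/(x k - (0 - z * cons_seq 0 (fun=> 0) k)).
  by rewrite xn//; case: k => [|k] /=; ring.
have -> : x = lp_cons (x 0%N) (lp_behead x) by apply: lp_eqP => -[|k].
apply: approx_cons; first exact: approx_range_cons1.
by apply: IH => k nk; apply: xn.
Qed.

(** Rescaling [x] by -(z/s) cancels the factor -(s/z) of the factorization. *)
Lemma tridiag_factor s r l z x : s != 0 -> z != 0 ->
  r - l = - s * (z + z^-1) ->
  let y := x - z *: lp_cons 0 x in
  let x' := (- (z / s)) *: x in
  tridiag p1 s r x' - l *: x' = y - z *: lp_behead y.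
Proof.
move=> s0 z0 rl y x'; apply: lp_eqP => k.
have -> : r = l - s * (z + z^-1) by rewrite -[LHS](subrK l) rl; ring.
(* [xm] is S x; its zero head lets one field identity cover row 0 as well. *)
pose xm := cons_seq 0 x.
pose c := - (z / s).
rewrite -[RHS]/((x k - z * xm k) - z * (x k.+1 - z * x k)).
rewrite -[LHS]/(s * (if k is j.+1 then c * x j else 0) +
  (l - s * (z + z^-1)) * (c * x k) + s * (c * x k.+1) - l * (c * x k)).
have -> : (if k is j.+1 then c * x j else 0) = c * xm k.
  by case: k => [|k] //=; rewrite mulr0.
by rewrite /c; field; rewrite s0 z0.
Qed.

Lemma tridiag_range_dense s r l : s != 0 ->
  dense (range (fun x => tridiag p1 s r x - l *: x)).
Proof.
move=> s0.
have [z [z0 z1 rl]] : exists z, [/\ z != 0, `|z| <= 1 & r - l = - s * (z + z^-1)].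
  (* The condition on [z] is z^2 + m z + 1 = 0. Its two roots have product 1, so one of them has
     modulus at most 1. *)
  pose m := (r - l) / s; pose d := sqrtc (m ^+ 2 - 4).
  pose z a := (- m + a) / 2.
  have zz : z d * z (- d) = 1.
    have : d ^+ 2 = m ^+ 2 - 4 by rewrite sqr_sqrtc.
    rewrite /z => dE.
    have -> : (- m + d) / 2 * ((- m - d) / 2) = (m ^+ 2 - d ^+ 2) / 4 by field.
    by rewrite dE; field.
  have key a : z a * z (- a) = 1 -> `|z a| <= 1 ->
      exists z, [/\ z != 0, `|z| <= 1 & r - l = - s * (z + z^-1)].
    move=> za1 za; have za0 : z a != 0.
      by apply/eqP => h; move/eqP: za1; rewrite h mul0r eq_sym oner_eq0.
    exists (z a); split => //.
    have -> : (z a)^-1 = z (- a) by rewrite -[RHS](mulKf za0) za1 mulr1.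
    by rewrite /z /m; field.
  have [zd|zd] := real_leP (normr_real (z d)) (real1 _); first exact: key zz zd.
  apply: (key (- d)); first by rewrite opprK mulrC.
  move/(congr1 Num.norm): zz; rewrite normrM normr1 => zz.
  by rewrite -zz ler_peMl// ltW.
apply: approx_dense => y.
apply: approx_trans (approx_finsupp y) => {}y [n yn].
have [w wn ->] := finsupp_sub_behead z yn.
(* Now y = (1 - z S* ) w. As |z| <= 1, the operator 1 - z S* at most doubles norms, so approximating
   [w] within e/2 suffices. *)
move=> e e0; have e20 : 0 < e / 2 by rewrite divr_gt0.
have [_ [x _ <-] wx] := approx_range_sub_cons z1 wn e20.
have xE := tridiag_factor x s0 z0 rl.
eexists; first by exists (- (z / s) *: x).
rewrite xE; set v := x - _ in wx *.
have -> : w - z *: lp_behead w - (v - z *: lp_behead v) =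
    (w - v) - z *: lp_behead (w - v).
  apply: lp_eqP => k.
  rewrite -[LHS]/(w k - z * w k.+1 - (v k - z * v k.+1)).
  by rewrite -[RHS]/((w k - v k) - z * (w k.+1 - v k.+1)); ring.
have zb : `|z *: lp_behead (w - v)| <= `|lp_behead (w - v)|.
  by rewrite normrZ ler_piMl.
have := ler_normB (w - v) (z *: lp_behead (w - v)).
move=> /le_trans; apply; apply: (lec_halfD wx).
exact: le_trans (le_trans zb (norm_lp_behead _)) wx.
Qed.

End TridiagRange.

Theorem corollary3p5 (R : realType) (p : R) (p_gt1 : 1 < p) (r s : R[i]) :
  residual_spectrum (tridiag (ltW p_gt1) s r) = set0.
Proof.
apply/seteqP; split => // l [inj nd]; apply: nd => /=.
have [s0|s0] := eqVneq s 0; last exact: tridiag_range_dense.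
have TE x : tridiag (ltW p_gt1) s r x - l *: x = (r - l) *: x.
  apply: lp_eqP => k; rewrite -[LHS]/(s * (if k is j.+1 then x j else 0) +
    r * x k + s * x k.+1 - l * x k) s0.
  by rewrite -[RHS]/((r - l) * x k); ring.
(* If r = l the operator is zero and sends both e_0 and 0 to 0, against injectivity; otherwise it is
   an invertible scalar, hence onto. *)
have [rl|rl] := eqVneq (r - l) 0.
  have : lp_cons 1 0 = 0 :> lp (ltW p_gt1) by apply: inj; rewrite /= !TE rl !scale0r.
  by move=> /(congr1 (fun x : lp _ => x 0%N))/eqP; rewrite oner_eq0.
move=> O [x Ox] _; exists x; split => //; exists ((r - l)^-1 *: x) => //.
by rewrite TE scalerA mulfV// scale1r.
Qed.
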